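(* For all positive integers $b,c$, $$R_c(x-y=bz)>\frac{\sqrt{(b+c-1)^2+8c^2(b^2+b)}-b-c+1}{2}.$$
   Context: For a positive integer $N$ let $[N]=\{1,\dots,N\}$. For a linear homogeneous equation $\mathcal{E}$ with integer coefficients and a positive integer $c$, the Rado number $R_c(\mathcal{E})$ is the least positive integer $N$ such that every $c$-coloring of $[N]$ contains a monochromatic solution to $\mathcal{E}$, i.e. a solution whose variables all take values in $[N]$ (not necessarily distinct) having the same color. If no such $N$ exists, $R_c(\mathcal{E})=\infty$. *)

(* Defs.v *)
From mathcomp Require Import all_boot all_order all_algebra.
From mathcomp Require Import boolp reals constructive_ereal.

Set Implicit Arguments.
Unset Strict Implicit.
Unset Printing Implicit Defensive.

Import GRing.Theory Num.Theory.

Local Open Scope ring_scope.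

(* The tuple a stands for the equation a_0 x_0 + ... + a_(m-1) x_(m-1) = 0.
   The set [N] = {1, ..., N} is encoded by 'I_N, the ordinal k standing for
   the integer k + 1. *)
Definition is_solution (m : nat) (a : m.-tuple int) (N : nat)
    (x : {ffun 'I_m -> 'I_N}) : bool :=
  \sum_(i < m) tnth a i * (x i).+1%:Z == 0.

Definition monochromatic (m c N : nat) (chi : {ffun 'I_N -> 'I_c})
    (x : {ffun 'I_m -> 'I_N}) : bool :=
  [forall i, forall j, chi (x i) == chi (x j)].

Definition every_coloring_has_mono_solution (c m : nat) (a : m.-tuple int)
    (N : nat) : bool :=
  [forall chi : {ffun 'I_N -> 'I_c},
     exists x : {ffun 'I_m -> 'I_N}, is_solution a x && monochromatic chi x].

Definition rado_number (R : realType) (c m : nat) (a : m.-tuple int) : \bar R :=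
  match pselect (exists N : nat,
      (0 < N)%N && every_coloring_has_mono_solution c a N) with
  | left exN => ((ex_minn exN)%:R)%:E
  | right _ => +oo%E
  end.

(* x - y = b z, i.e. 1 x + (-1) y + (-b) z = 0. *)
Definition eq_x_sub_y_eq_bz (b : nat) : 3.-tuple int :=
  [tuple 1; -1; - b%:Z].

(* Main.v *)
Require Import Defs.
From mathcomp Require Import all_boot all_order all_algebra.
From mathcomp Require Import boolp reals constructive_ereal.
From mathcomp Require Import zify lra.

Import GRing.Theory Num.Theory.

Local Open Scope ring_scope.

(* Put B = b + 1 and colour k by the integer part of log_B k. If y and z lie
   in [B^t, B^(t+1)), then y + b z >= (1 + b) B^t = B^(t+1), so no colour class
   contains a solution. Hence R_c >= B^c, which exceeds the quadratic bound. *)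

Lemma trunc_log_no_solution (b x y z : nat) :
  (0 < b)%N -> (0 < y)%N -> (0 < z)%N -> x = (y + b * z)%N ->
  trunc_log b.+1 x = trunc_log b.+1 y -> trunc_log b.+1 x <> trunc_log b.+1 z.
Proof.
move=> b0 y0 z0 exyz exy exz.
have b1 : (1 < b.+1)%N by [].
have x0 : (0 < x)%N by lia.
have /andP[_] := trunc_log_bounds b1 x0.
have /andP[+ _] := trunc_log_bounds b1 y0.
have /andP[+ _] := trunc_log_bounds b1 z0.
rewrite -exz -exy expnS.
set t := (b.+1 ^ _)%N => tz ty; rewrite ltnNge exyz mulSn.
by rewrite leq_add // leq_mul2l tz orbT.
Qed.

Lemma is_solution_eq_x_sub_y_eq_bz (b N : nat) (x : {ffun 'I_3 -> 'I_N}) :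
  is_solution (eq_x_sub_y_eq_bz b) x ->
  (x ord0).+1 = ((x (inord 1)).+1 + b * (x (inord 2)).+1)%N.
Proof.
rewrite /is_solution !big_ord_recl big_ord0 => /eqP.
have -> : lift ord0 ord0 = inord 1 :> 'I_3 by apply/val_inj; rewrite /= inordK.
have -> : lift ord0 (lift ord0 ord0) = inord 2 :> 'I_3.
  by apply/val_inj; rewrite /= inordK.
rewrite !(tnth_nth 0) /= !inordK //=; lia.
Qed.

Lemma expn_le_mono_solution (b c N : nat) :
  (0 < b)%N -> every_coloring_has_mono_solution c (eq_x_sub_y_eq_bz b) N ->
  (b.+1 ^ c <= N)%N.
Proof.
move=> b0 /forallP hN; rewrite leqNgt; apply/negP => ltN.
(* The ordinal [k] stands for [k + 1], which is at most [N < (b+1)^c], so its logarithm is one of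
   the [c] colours. *)
have log_lt (k : 'I_N) : (trunc_log b.+1 k.+1 < c)%N.
  by rewrite -(@ltn_exp2l b.+1) //; apply: leq_ltn_trans (trunc_logP _ _) _;
    rewrite // (leq_ltn_trans (ltn_ord k)).
have /existsP[x /andP[/is_solution_eq_x_sub_y_eq_bz sol /forallP mono]] :=
  hN [ffun k => Ordinal (log_lt k)].
have same j : trunc_log b.+1 (x ord0).+1 = trunc_log b.+1 (x j).+1.
  by have /forallP/(_ j) := mono ord0; rewrite !ffunE => /eqP/(congr1 val).
exact: (trunc_log_no_solution b _ _ _ b0 _ _ sol (same _) (same _)).
Qed.

(** The bound of the theorem is the positive root of [N (N + b + c - 1) = 2 c^2 b (b + 1)]; this
    places [N = (b+1)^c] beyond that root without square roots. *)
Lemma quadratic_lt_expn (b c : nat) : (0 < b)%N -> (0 < c)%N ->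
  (2 * c ^ 2 * (b * b.+1) < b.+1 ^ c * (b.+1 ^ c + b + c.-1))%N.
Proof.
(* For one colour the linear term matters: the claim becomes [2b < 2b + 1] after division by
   [b + 1]. *)
move=> b0; case: c => [//|[_|c _]]; first by rewrite !expn1 exp1n; nia.
(* From two colours on the square alone suffices; the base case is [8b <= (b+1)^3], tight at
   [b = 1]. *)
suff sq : (2 * c.+2 ^ 2 * (b * b.+1) <= b.+1 ^ c.+2 * b.+1 ^ c.+2)%N.
  apply: leq_ltn_trans sq _; rewrite ltn_pmul2l ?expn_gt0 //=; lia.
elim: c => [|c IH]; first by rewrite !expnS !expn0; nia.
rewrite (expnS b.+1 c.+2) [leqRHS]mulnACA.
(* One more colour multiplies the right side by [(b+1)^2 >= 4] and the left by
   [((c+3)/(c+2))^2 <= 4]. *)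
apply: (@leq_trans (2 * 2 * (2 * c.+2 ^ 2 * (b * b.+1)))); last first.
  by rewrite leq_mul // leq_mul.
rewrite [leqRHS]mulnA leq_mul2r; apply/orP; right; rewrite -!mulnn; nia.
Qed.

Theorem corollary5p7 (R : realType) (b c : nat) (hb : (0 < b)%N) (hc : (0 < c)%N) :
  (((Num.sqrt ((b%:R + c%:R - 1) ^+ 2 + 8 * c%:R ^+ 2 * (b%:R ^+ 2 + b%:R))
      - b%:R - c%:R + 1) / 2 : R)%:E
   < rado_number R c (eq_x_sub_y_eq_bz b))%E.
Proof.
rewrite /rado_number; case: pselect => [exN|_]; last by rewrite ltry.
case: ex_minnP => N /andP[_ hN] _; rewrite lte_fin.
have leN := expn_le_mono_solution _ _ _ hb hN.
have ltN : (2 * c ^ 2 * (b * b.+1) < N * (N + b + c.-1))%N.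
  apply: leq_trans (quadratic_lt_expn _ _ hb hc) _.
  by rewrite leq_mul // !leq_add2r.
have cE : c.-1%:R = c%:R - 1 :> R by rewrite -[in RHS](prednK hc) -natr1 addrK.
move: ltN; rewrite -(ltr_nat R) !natrM !natrD cE => ltN.
have b1 : 1 <= b%:R :> R by rewrite ler1n.
have c1 : 1 <= c%:R :> R by rewrite ler1n.
have N0 : 0 <= N%:R :> R by rewrite ler0n.
rewrite ltr_pdivrMr; last by lra.
suff : Num.sqrt ((b%:R + c%:R - 1) ^+ 2 + 8 * c%:R ^+ 2 * (b%:R ^+ 2 + b%:R))
    < 2 * N%:R + b%:R + c%:R - 1 :> R by lra.
have s0 : 0 < 2 * N%:R + b%:R + c%:R - 1 :> R by lra.
(* With [s = b + c - 1], comparing squares leaves [8 c^2 (b^2 + b) < (2N + s)^2 - s^2 = 4 N (N +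
   s)], which is four times [ltN]. *)
rewrite -[ltRHS]gtr0_norm // -sqrtr_sqr ltr_sqrt ?exprn_gt0 //.
nra.
Qed.
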